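(* Let $A$ be a separable unital C*-algebra, let $\alpha \in \mathrm{Aut}(A)$ be approximately inner and satisfy $\alpha^n = \mathrm{id}_A$, and suppose that the action of $\mathbb{Z}/n\mathbb{Z}$ generated by $\alpha$ has the strict Rokhlin property. Then the action of $\mathbb{Z}/n\mathbb{Z}$ generated by $\alpha$ is approximately representable.
   Context: The action generated by $\alpha$ is $k \mapsto \alpha^k$ for $k \in \mathbb{Z}/n\mathbb{Z}$. The automorphism $\alpha$ is approximately inner if for every finite $F \subset A$ and $\varepsilon > 0$ there is a unitary $u \in A$ with $\|u a u^* - \alpha(a)\| < \varepsilon$ for all $a \in F$. Strict Rokhlin property: an action $\gamma \colon G \to \mathrm{Aut}(A)$ of a finite group $G$ on a separable unital C*-algebra $A$ has the strict Rokhlin property if for every finite set $F \subset A$ and every $\varepsilon > 0$, there are mutually orthogonal projections $e_g \in A$ for $g \in G$ such that: (1) $\|\gamma_g(e_h) - e_{gh}\| < \varepsilon$ for all $g, h \in G$; (2) $\|e_g a - a e_g\| < \varepsilon$ for all $g \in G$ and $a \in F$; (3) $\sum_{g \in G} e_g = 1$. Approximate representability: an action $\gamma \colon G \to \mathrm{Aut}(A)$ of a finite abelian group $G$ on a separable unital C*-algebra $A$ is approximately representable if for every finite set $F \subset A$ and every $\varepsilon > 0$, there are unitaries $w_g \in A$ for $g \in G$ such that: (1) $\|\gamma_g(a) - w_g a w_g^*\| < \varepsilon$ for all $a \in F$ and $g \in G$; (2) $\|w_g w_h - w_{gh}\| < \varepsilon$ for all $g, h \in G$; (3) $\|\gamma_g(w_h)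 - w_h\| < \varepsilon$ for all $g, h \in G$. *)

(* Defs.v *)
From HB Require Import structures.
From mathcomp Require Import all_boot all_order all_algebra all_fingroup.
From mathcomp Require Import all_classical all_reals.
From mathcomp Require Import complex.

Set Implicit Arguments.
Unset Strict Implicit.
Unset Printing Implicit Defensive.

Import Order.TTheory GRing.Theory Num.Theory.

Local Open Scope ring_scope.
Local Open Scope complex_scope.

(* The norm is R-valued and the scalars are in R[i], for a model R of the real
   numbers.  A pzRingType cannot be joined with a normedModType or an lmodType,
   since numDomainType and lalgType already are the joins, and both of these
   impose 1 != 0.  The axioms of the scaling and of the norm are therefore
   fields of this mixin over pzRingType, which admits the zero algebra. *)
HB.mixin Record isUnitalCStarAlgebra (R : realType) A of GRing.PzRing A := {
  cscale : R[i] -> A -> A ;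
  cscaleA : forall c d x, cscale c (cscale d x) = cscale (c * d) x ;
  cscale1 : forall x, cscale 1 x = x ;
  cscaleDr : forall c x y, cscale c (x + y) = cscale c x + cscale c y ;
  cscaleDl : forall c d x, cscale (c + d) x = cscale c x + cscale d x ;
  cscaleAl : forall c x y, cscale c (x * y) = cscale c x * y ;
  cscaleAr : forall c x y, cscale c (x * y) = x * cscale c y ;
  cnorm : A -> R ;
  cnorm0_eq0 : forall x, cnorm x = 0 -> x = 0 ;
  cnormD : forall x y, cnorm (x + y) <= cnorm x + cnorm y ;
  cnormZ : forall c x, cnorm (cscale c x) = Normc.normc c * cnorm x ;
  cnormM : forall x y, cnorm (x * y) <= cnorm x * cnorm y ;
  cnorm_complete : forall u : nat -> A,
    (forall eps : R, 0 < eps -> exists N, forall m n,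
      (N <= m)%N -> (N <= n)%N -> cnorm (u m - u n) < eps) ->
    exists l : A, forall eps : R, 0 < eps -> exists N, forall n,
      (N <= n)%N -> cnorm (u n - l) < eps ;
  star : A -> A ;
  starK : involutive star ;
  starD : {morph star : x y / x + y} ;
  starZ : forall c x, star (cscale c x) = cscale c^* (star x) ;
  starM : forall x y, star (x * y) = star y * star x ;
  cnorm_star : forall x, cnorm (star x * x) = cnorm x ^+ 2
}.

#[short(type="unitalCStarAlgType")]
HB.structure Definition UnitalCStarAlgebra (R : realType) :=
  {A of GRing.PzRing A & isUnitalCStarAlgebra R A}.

Section Definitions.
Variables (R : realType) (A : unitalCStarAlgType R).

Definition separable : Prop := exists2 D : set A, countable D &
  forall (x : A) (eps : R), 0 < eps -> exists2 d, D d & cnorm (x - d) < eps.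

Definition unitary (u : A) : Prop := star u * u = 1 /\ u * star u = 1.

Definition projection (p : A) : Prop := star p = p /\ p * p = p.

Record starAut := StarAut {
  aut_fun :> {rmorphism A -> A} ;
  aut_scalable : forall (c : R[i]) (x : A),
    aut_fun (cscale c x) = cscale c (aut_fun x) ;
  aut_star : {morph aut_fun : x / star x} ;
  aut_bij : bijective aut_fun
}.

Definition approximately_inner (alpha : starAut) : Prop :=
  forall (F : seq A) (eps : R), 0 < eps ->
  exists2 u : A, unitary u &
    forall a, a \in F -> cnorm (u * a * star u - alpha a) < eps.

Record autAction (G : finGroupType) := AutAction {
  act_aut :> G -> starAut ;
  act_1 : act_aut 1%g =1 id ;
  act_M : forall g h : G, act_aut (g * h)%g =1 act_aut g \o act_aut h
}.

Section Properties.
Variables (G : finGroupType) (gamma : autAction G).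

Definition strict_Rokhlin : Prop :=
  forall (F : seq A) (eps : R), 0 < eps ->
  exists e : G -> A,
    [/\ (forall g, projection (e g)) /\
        (forall g h, g != h -> e g * e h = 0),
        (forall g h, cnorm (gamma g (e h) - e (g * h)%g) < eps),
        (forall g a, a \in F -> cnorm (e g * a - a * e g) < eps) &
        \sum_(g : G) e g = 1].

Definition approximately_representable : Prop :=
  abelian [set: G] /\
  forall (F : seq A) (eps : R), 0 < eps ->
  exists w : G -> A,
    [/\ (forall g, unitary (w g)),
        (forall g a, a \in F -> cnorm (gamma g a - w g * a * star (w g)) < eps),
        (forall g h, cnorm (w g * w h - w (g * h)%g) < eps) &
        (forall g h, cnorm (gamma g (w h) - w h) < eps)].

End Properties.

Section Power.
Variables (alpha : starAut) (k : nat).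

Definition iter_aut : A -> A := iter k alpha.

Fact iter_aut_zmod_morphism : zmod_morphism iter_aut.
Proof.
by rewrite /iter_aut => x y; elim: k => //= m ->; rewrite rmorphB.
Qed.

Fact iter_aut_monoid_morphism : monoid_morphism iter_aut.
Proof.
rewrite /iter_aut; split; first by elim: k => //= m ->; rewrite rmorph1.
by move=> x y; elim: k => //= m ->; rewrite rmorphM.
Qed.

HB.instance Definition _ :=
  Algebra.isZmodMorphism.Build A A iter_aut iter_aut_zmod_morphism.
HB.instance Definition _ :=
  GRing.isMonoidMorphism.Build A A iter_aut iter_aut_monoid_morphism.

Fact iter_aut_scalable (c : R[i]) (x : A) :
  iter_aut (cscale c x) = cscale c (iter_aut x).
Proof. by rewrite /iter_aut; elim: k => //= m ->; rewrite aut_scalable. Qed.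

Fact iter_aut_star : {morph iter_aut : x / star x}.
Proof. by rewrite /iter_aut => x; elim: k => //= m ->; rewrite aut_star. Qed.

Fact iter_aut_bij : bijective iter_aut.
Proof.
rewrite /iter_aut; elim: k => [|m IHm]; first by exists id.
exact: bij_comp (aut_bij alpha) IHm.
Qed.

Definition aut_pow : starAut :=
  @StarAut iter_aut iter_aut_scalable iter_aut_star iter_aut_bij.

End Power.

(* 'I_n.+1 with its additive group structure is Z/(n+1)Z; 'Z_n is
   not used because 'Z_1 is not trivial. *)
Section CyclicAction.
Variables (n : nat) (alpha : starAut) (alpha_n : iter n.+1 alpha =1 id).

Fact cyclic_action_1 : aut_pow alpha (1%g : 'I_n.+1) =1 id.
Proof. by []. Qed.

Fact cyclic_action_M (i j : 'I_n.+1) :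
  aut_pow alpha (i * j)%g =1 aut_pow alpha i \o aut_pow alpha j.
Proof.
move=> x; rewrite /= /iter_aut -iterD.
have iter_mul m : iter (m * n.+1)%N alpha x = x.
  by elim: m => // m IHm; rewrite mulSn iterD IHm alpha_n.
by rewrite [in RHS](divn_eq (i + j) n.+1) [in RHS]addnC [in RHS]iterD iter_mul.
Qed.

Definition cyclic_action : autAction 'I_n.+1 :=
  @AutAction 'I_n.+1 (fun k => aut_pow alpha k) cyclic_action_1 cyclic_action_M.

End CyclicAction.

End Definitions.

Arguments separable {R} A.

(* Main.v *)
From HB Require Import structures.
Require Import Defs.
From mathcomp Require Import all_boot all_order all_algebra all_fingroup.
From mathcomp Require Import all_classical all_reals complex.
From mathcomp Require Import ring lra.

(** Write N for n.+1, the order of the cyclic group.  The approximations are made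
    exact by passing to the sequence algebra [seqalg A], the bounded sequences
    of A modulo those that tend to 0, in which A sits as constant sequences and
    on which alpha acts termwise.  A choice of approximate solutions with error
    1/(m+1) at the m-th term is one exact solution there, so for every finite
    subset of the sequence algebra approximate innerness gives a unitary u with
    u a = alpha(a) u on this set ([seqalg_inner]), and the strict Rokhlin
    property gives projections e_i of sum 1, permuted cyclically by alpha, that
    commute with this set ([seqalg_rokhlin]).

    The rest is algebra in a ring with involution.  Take an alpha-invariant
    finite set F, a Rokhlin tower e commuting with F, and then u implementing
    alpha on F and on the e_i.  The unitary z = u^N implements alpha^N = id,
    hence commutes with F, with the e_i and with u.  The unitary
    w = u (z^* e_0 + (1 - e_0)) still implements alpha on F, and it also shifts
    the e_i.  A path of N steps around the cycle meets e_0 exactly once, so the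
    factor z^* is picked up once and w^N = z z^* = 1
    ([exists_periodic_intertwiner]).  A second tower f, commuting with F and
    with the iterates of w, gives v = \sum_i alpha^i(w) f_i.  On elements whose
    iterates commute with f this averaging is a homomorphism with alpha-fixed
    values, so v is a unitary with v^N = 1 and alpha(v) = v, and it implements
    alpha on F since every alpha^i(w) does ([exists_invariant_intertwiner]).

    A unitary of the sequence algebra is represented by a sequence of unitaries
    v_m of A, by polar decomposition ([unitary_lift]).  The relations for v say
    that w_g = v_m^g satisfies the three conditions of approximate
    representability up to errors that tend to 0 with m. *)

Set Implicit Arguments.
Unset Strict Implicit.
Unset Printing Implicit Defensive.

Import Order.TTheory GRing.Theory Num.Theory.

Local Open Scope classical_set_scope.
Local Open Scope ring_scope.
Local Open Scope complex_scope.

(** * Rings with involution *)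

Section InvolutiveRing.
Variables (B : pzRingType) (st : B -> B).
Hypotheses (stK : involutive st) (stD : {morph st : x y / x + y}).
Hypotheses (stM : forall x y, st (x * y) = st y * st x).
Implicit Types (u w x y : B).

Definition unitary_for u := st u * u = 1 /\ u * st u = 1.

Lemma invol0 : st 0 = 0.
Proof. by apply: (addrI (st 0)); rewrite -stD !addr0. Qed.

Lemma involN : {morph st : x / - x}.
Proof. by move=> x; apply: (addrI (st x)); rewrite -stD !subrr invol0. Qed.

Lemma invol1 : st 1 = 1.
Proof. by have := stM 1 (st 1); rewrite mul1r stK mul1r. Qed.

Lemma unitary_forM u w : unitary_for u -> unitary_for w -> unitary_for (u * w).
Proof.
move=> [u1 u2] [w1 w2]; rewrite /unitary_for stM; split.
  by rewrite mulrA -(mulrA (st w)) u1 mulr1.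
by rewrite mulrA -(mulrA u) w2 mulr1.
Qed.

Lemma unitary_forX u k : unitary_for u -> unitary_for (u ^+ k).
Proof.
move=> uU; elim: k => [|k IHk].
  by rewrite /unitary_for expr0 invol1 mul1r.
by rewrite exprS; apply: unitary_forM.
Qed.

End InvolutiveRing.

(** * Periodic iteration *)

Lemma iter_mod_period (T : Type) (f : T -> T) n : iter n.+1 f =1 id ->
  forall k x, iter (k %% n.+1) f x = iter k f x.
Proof.
move=> fn k x; rewrite [in RHS](divn_eq k n.+1) addnC iterD.
congr (iter _ _ _).
by elim: (k %/ _)%N => // m IHm; rewrite mulSn iterD -IHm fn.
Qed.

Lemma val_iter_ordS n k : iter k (@ordS n.+1) ord0 = (k %% n.+1)%N :> nat.
Proof.
by elim: k => [|k IHk] /=; rewrite ?mod0n // IHk -addn1 modnDml addn1.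
Qed.

Lemma iter_ordS n (i : 'I_n.+1) : i = iter i (@ordS n.+1) ord0.
Proof. by apply: val_inj; rewrite /= val_iter_ordS modn_small. Qed.

(** * Intertwiners and Rokhlin towers *)

Section ExactRokhlin.
Variables (B : pzRingType) (st : B -> B) (al : {rmorphism B -> B}) (n : nat).
Hypotheses (stK : involutive st) (stD : {morph st : x y / x + y}).
Hypotheses (stM : forall x y, st (x * y) = st y * st x).
Hypotheses (al_st : {morph al : x / st x}) (al_n : iter n.+1 al =1 id).
Implicit Types (F : seq B) (e f : 'I_n.+1 -> B) (u w x y : B).

(** The strict Rokhlin property with zero error.  It suffices to record the action
    of the generator. *)
Record rokhlin_tower e : Prop := RokhlinTower {
  tower_st : forall i, st (e i) = e i;
  tower_mul : forall i j, e i * e j = if i == j then e i else 0;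
  tower_al : forall i, al (e i) = e (ordS i);
  tower_sum : \sum_i e i = 1 }.

Definition intertwines F w := forall a, a \in F -> w * a = al a * w.

Lemma invol_sum (e : 'I_n.+1 -> B) : st (\sum_i e i) = \sum_i st (e i).
Proof. exact: (big_morph st stD (invol0 stD)). Qed.

Lemma iter_al_st k x : iter k al (st x) = st (iter k al x).
Proof. by elim: k => //= k ->. Qed.

Lemma iter_intertwines F w k a :
  (forall b, b \in F -> al b \in F) -> intertwines F w -> a \in F ->
  w ^+ k * a = iter k al a * w ^+ k.
Proof.
move=> stF wF aF; elim: k => [|k IHk]; first by rewrite expr0 mul1r mulr1.
have akF : iter k al a \in F by elim: k {IHk} => //= k; apply: stF.
by rewrite exprS -mulrA IHk mulrA wF // -mulrA.
Qed.

Section Root.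
Variables (F : seq B) (e : 'I_n.+1 -> B) (u : B).
Hypotheses (stF : forall a, a \in F -> al a \in F) (towE : rokhlin_tower e).
Hypotheses (eF : forall i a, a \in F -> e i * a = a * e i).
Hypotheses (uU : unitary_for st u) (uF : intertwines F u).
Hypotheses (ue : forall i, u * e i = e (ordS i) * u).

(* Since [u * y] shifts the steps and differs from [u] on step [ord0] only, its
   [n.+1]-st power acts on a step as [z * st z]. *)
Let z := u ^+ n.+1.
Let y := st z * e ord0 + (1 - e ord0).

Let zU : unitary_for st z. Proof. exact: unitary_forX. Qed.

Let ze i : z * e i = e i * z.
Proof.
have stE a : a \in codom e -> al a \in codom e.
  by case/codomP=> k ->; rewrite tower_al ?codom_f.
have uE : intertwines (codom e) u.
  by move=> a /codomP[k ->]; rewrite ue tower_al.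
by rewrite (iter_intertwines _ stE uE) ?codom_f // al_n.
Qed.

Let zF a : a \in F -> z * a = a * z.
Proof. by move=> aF; rewrite (iter_intertwines _ stF uF aF) al_n. Qed.

Let st_comm x a : unitary_for st x -> x * a = a * x -> st x * a = a * st x.
Proof.
case=> x1 x2 xa; rewrite -[LHS]mulr1 -x2 mulrA -(mulrA (st x)) -xa.
by rewrite mulrA x1 mul1r.
Qed.

Let sze i : st z * e i = e i * st z.
Proof. exact: st_comm. Qed.

Let e0e0 : e ord0 * e ord0 = e ord0.
Proof. by rewrite tower_mul // eqxx. Qed.

Let ye0 : y * e ord0 = st z * e ord0.
Proof. by rewrite /y mulrDl mulrBl mul1r -mulrA e0e0 subrr addr0. Qed.

Let ye i : i != ord0 -> y * e i = e i.
Proof.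
move=> i0; rewrite /y mulrDl mulrBl mul1r -mulrA tower_mul //.
by rewrite eq_sym (negbTE i0) mulr0 subr0 add0r.
Qed.

Let y_comm a : e ord0 * a = a * e ord0 -> z * a = a * z -> y * a = a * y.
Proof.
move=> ea /(st_comm zU) za; rewrite /y mulrDl mulrBl mul1r mulrDr mulrBr mulr1.
by rewrite -mulrA ea mulrA za mulrA.
Qed.

Let yU : unitary_for st y.
Proof.
case: zU => z1 z2.
have sy : st y = z * e ord0 + (1 - e ord0).
  by rewrite /y !stD involN // invol1 // stM stK tower_st // ze.
have ce0 : (1 - e ord0) * e ord0 = 0 by rewrite mulrBl mul1r e0e0 subrr.
have e0c : e ord0 * (1 - e ord0) = 0 by rewrite mulrBr mulr1 e0e0 subrr.
have cc : (1 - e ord0) * (1 - e ord0) = 1 - e ord0.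
  by rewrite mulrBr mulr1 ce0 subr0.
rewrite /unitary_for {}sy /y; move: (1 - e ord0) (subrK (e ord0) 1) ce0 e0c cc.
move=> c ce ce0 e0c cc.
have mulE p q : p * q = 1 -> q * e ord0 = e ord0 * q ->
    (p * e ord0 + c) * (q * e ord0 + c) = 1.
  move=> pq qe; rewrite qe mulrDl !mulrDr cc -!mulrA e0c mulr0 addr0.
  rewrite [c * (_ * _)]mulrA ce0 mul0r add0r (mulrA (e ord0)) e0e0.
  by rewrite -qe mulrA pq mul1r addrC ce.
by split; rewrite mulE.
Qed.

(** Cutting [u] down by one step of a tower that it permutes cyclically
    concentrates the defect [u ^+ n.+1] of periodicity on a single step, where
    it can be divided out. *)
Lemma exists_periodic_intertwiner :
  exists w, [/\ unitary_for st w, w ^+ n.+1 = 1 & intertwines F w].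
Proof.
exists (u * y); split; first exact: unitary_forM.
- have we i : u * y * e i = e (ordS i) * (u * y).
    rewrite -mulrA (y_comm (a := e i)) ?ze //; first by rewrite mulrA ue mulrA.
    by rewrite !tower_mul // eq_sym; case: eqP => // ->.
  have wU : unitary_for st (u * y) by exact: unitary_forM.
  have wN0 : (u * y) ^+ n.+1 * e ord0 = e ord0.
    (* The first n steps from the step after [ord0] do not meet [ord0], the only
       place where w differs from u. *)
    have wk k : (k <= n)%N ->
        (u * y) ^+ k * e (ordS ord0) = u ^+ k * e (ordS ord0).
      elim: k => [|k IHk] kn; first by rewrite !expr0.
      have uk :
          u ^+ k * e (ordS ord0) = e (iter k.+1 (@ordS n.+1) ord0) * u ^+ k.
        elim: (k) => [|j IHj]; first by rewrite !expr0 mul1r mulr1.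
        by rewrite exprS -mulrA IHj mulrA ue -mulrA.
      rewrite !exprS -[LHS]mulrA IHk ?(ltnW kn) // -[RHS]mulrA uk !mulrA.
      congr (_ * _); rewrite -[LHS]mulrA ye //.
      apply/eqP => /(congr1 (@nat_of_ord _)).
      by rewrite val_iter_ordS modn_small.
    rewrite exprSr -mulrA -(mulrA u y) ye0 sze (mulrA u) ue -mulrA.
    rewrite (mulrA _ (e _)) wk // -mulrA (mulrA (e _)) -ue -mulrA -sze !mulrA.
    by rewrite -exprSr -/z; case: zU => _ ->; rewrite mul1r.
  (* [w] conjugates each step to the next one and commutes with [w ^+ n.+1]. *)
  have wN i : (u * y) ^+ n.+1 * e i = e i.
    rewrite (iter_ordS i); elim: (nat_of_ord i) => //= k IHk.
    set j := iter k _ _ in IHk *.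
    have -> : e (ordS j) = u * y * e j * st (u * y).
      by rewrite we -mulrA; case: wU => _ ->; rewrite mulr1.
    move: (u * y) wU IHk => w _ IHk.
    by rewrite !mulrA -exprSr exprS -!mulrA [_ ^+ _ * (e j * _)]mulrA IHk.
  rewrite -[LHS]mulr1 -(tower_sum towE) mulr_sumr.
  by under eq_bigr do rewrite wN.
- move=> a aF; rewrite -mulrA (y_comm (a := a)) ?eF ?zF //.
  by rewrite mulrA uF // mulrA.
Qed.

End Root.

Section Averaging.
Variables (F : seq B) (f : 'I_n.+1 -> B) (w : B).
Hypotheses (stF : forall a, a \in F -> al a \in F) (towF : rokhlin_tower f).
Hypotheses (fF : forall i a, a \in F -> f i * a = a * f i).
Hypotheses (wU : unitary_for st w) (wN : w ^+ n.+1 = 1) (wF : intertwines F w).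
Hypotheses (fw : forall i k, f i * iter k al w = iter k al w * f i).

Let avg x := \sum_(i < n.+1) iter i al x * f i.

(* The diagonal terms use that [f i] commutes with the iterates of [y] and is
   idempotent; the others vanish by orthogonality of the steps. *)
Let avgM x y : (forall i k, f i * iter k al y = iter k al y * f i) ->
  avg (x * y) = avg x * avg y.
Proof.
move=> fy; rewrite /avg mulr_suml; apply: eq_bigr => i _.
rewrite mulr_sumr (bigD1 i) //= big1 ?addr0.
  have -> : iter i al (x * y) = iter i al x * iter i al y.
    by elim: (nat_of_ord i) => //= k ->; rewrite rmorphM.
  rewrite -[RHS]mulrA (mulrA (f i)) fy -[_ * f i * f i]mulrA tower_mul // eqxx.
  by rewrite mulrA.
move=> j ji; rewrite -mulrA (mulrA (f i)) fy -mulrA tower_mul //.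
by rewrite eq_sym (negbTE ji) !mulr0.
Qed.

Let al_avg x : al (avg x) = avg x.
Proof.
rewrite /avg rmorph_sum [RHS](reindex_inj (@ordS_inj n.+1)) /=.
by apply: eq_bigr => i _; rewrite rmorphM tower_al // (iter_mod_period al_n).
Qed.

Let avg_1 : avg 1 = 1.
Proof.
rewrite /avg -[RHS](tower_sum towF); apply: eq_bigr => i _.
have -> k : iter k al 1 = 1 by elim: k => //= k ->; rewrite rmorph1.
by rewrite mul1r.
Qed.

Let avgX k : avg (w ^+ k) = avg w ^+ k.
Proof.
by elim: k => [|k IHk]; rewrite ?expr0 ?avg_1 // !exprSr avgM // IHk.
Qed.

Let fsw i k : f i * iter k al (st w) = iter k al (st w) * f i.
Proof.
by rewrite iter_al_st -{1}(tower_st towF) -stM -fw stM tower_st.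
Qed.

Let avg_st : st (avg w) = avg (st w).
Proof.
rewrite /avg invol_sum; apply: eq_bigr => i _.
by rewrite stM tower_st // iter_al_st -iter_al_st fsw.
Qed.

(** Spreading the iterates of [w] over the steps of a tower that commutes with
    them averages [w] over the action while remaining multiplicative. *)
Lemma exists_invariant_intertwiner :
  exists v, [/\ unitary_for st v, v ^+ n.+1 = 1, al v = v & intertwines F v].
Proof.
have [w1 w2] := wU.
exists (avg w); split.
- by rewrite /unitary_for avg_st -!avgM // w1 w2 avg_1.
- by rewrite -avgX wN avg_1.
- exact: al_avg.
move=> a aF; rewrite /avg mulr_suml mulr_sumr; apply: eq_bigr => i _.
rewrite -mulrA fF // !mulrA; congr (_ * _).
elim: (nat_of_ord i) a aF => [|k IHk] a aF; first exact: wF.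
have stFn j : iter j al a \in F by elim: j => //= j; apply: stF.
have {1}<- : al (iter n al a) = a by rewrite -iterS al_n.
by rewrite /= -rmorphM IHk // rmorphM -iterS al_n.
Qed.

End Averaging.

(** The order of the choices matters: [u] has to permute the first tower, so it is
    chosen after it, whereas the second tower has to commute with the iterates
    of [w] and is chosen last. *)
Lemma exists_invariant_periodic_intertwiner F :
    (forall a, a \in F -> al a \in F) ->
    (forall G : seq B, exists2 u, unitary_for st u & intertwines G u) ->
    (forall G : seq B, exists2 e, rokhlin_tower e &
       forall i a, a \in G -> e i * a = a * e i) ->
  exists v, [/\ unitary_for st v, v ^+ n.+1 = 1, al v = v & intertwines F v].
Proof.
move=> stF inner rokhlin; have [e towE eF] := rokhlin F.
have [u uU uF] := inner (F ++ codom e).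
have [||w [wU wN wF]] := exists_periodic_intertwiner stF towE eF uU.
- by move=> a aF; apply: uF; rewrite mem_cat aF.
- by move=> i; rewrite uF ?tower_al // mem_cat codom_f orbT.
have [f towF fF] := rokhlin (F ++ [seq iter k al w | k <- iota 0 n.+1]).
apply: (exists_invariant_intertwiner stF towF) wU wN wF _ => [i a aF|i k].
  by apply: fF; rewrite mem_cat aF.
apply: fF; rewrite mem_cat -(iter_mod_period al_n); apply/orP; right.
by apply/mapP; exists (k %% n.+1)%N; rewrite // mem_iota add0n ltn_pmod.
Qed.

End ExactRokhlin.

(** * The norm *)

Section CStarNorm.
Variables (R : realType) (A : unitalCStarAlgType R).
Implicit Types x y u p : A.

Lemma cscale0 x : cscale (0 : R[i]) x = 0.
Proof. by apply: (addrI (cscale 0 x)); rewrite -cscaleDl !addr0. Qed.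

Lemma cscaleN1 x : cscale (-1 : R[i]) x = - x.
Proof.
apply: (addrI x); rewrite subrr -{1}[x](@cscale1 R) -cscaleDl subrr.
exact: cscale0.
Qed.

Lemma cnorm0 : cnorm (0 : A) = 0.
Proof. by rewrite -(cscale0 0) cnormZ Normc.normc0 mul0r. Qed.

Lemma cnormN x : cnorm (- x) = cnorm x.
Proof.
rewrite -cscaleN1 cnormZ.
suff -> : Normc.normc (-1 : R[i]) = 1 by rewrite mul1r.
by rewrite /Normc.normc /= oppr0 expr0n addr0 sqrrN expr1n sqrtr1.
Qed.

Lemma cnorm_ge0 x : 0 <= cnorm x.
Proof.
have := cnormD x (- x); rewrite subrr cnorm0 cnormN -mulr2n.
by rewrite pmulrn_lge0.
Qed.

Lemma cnormB x y : cnorm (x - y) <= cnorm x + cnorm y.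
Proof. by rewrite -(cnormN y) cnormD. Qed.

Lemma cnorm_sym x y : cnorm (x - y) = cnorm (y - x).
Proof. by rewrite -opprB cnormN. Qed.

Lemma cnorm_star_id x : cnorm (star x) = cnorm x.
Proof.
have le_star y : cnorm y <= cnorm (star y).
  have [->|y0] := eqVneq (cnorm y) 0; first exact: cnorm_ge0.
  have y_gt0 : 0 < cnorm y by rewrite lt_def y0 cnorm_ge0.
  by rewrite -(ler_pM2r y_gt0) -expr2 -cnorm_star cnormM.
by apply/le_anti; rewrite le_star -{2}(starK x) le_star.
Qed.

Lemma star1 : star (1 : A) = 1.
Proof. exact: invol1 (@starK R A) (@starM R A). Qed.

Lemma starB : {morph (star : A -> A) : x y / x - y}.
Proof. by move=> x y; rewrite starD (involN (@starD R A)). Qed.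

(** The C*-identity gives [cnorm p ^+ 2 = cnorm p]. *)
Lemma projection_cnorm_le1 p : projection p -> cnorm p <= 1.
Proof.
case=> sp pp; have := cnorm_star p; rewrite sp pp => /eqP.
rewrite eq_sym expr2 -subr_eq0 -{3}[cnorm p]mulr1 -mulrBr mulf_eq0 subr_eq0.
by case/orP => /eqP ->.
Qed.

Lemma unitary_cnorm_le1 u : unitary u -> cnorm u <= 1.
Proof.
case=> uu _; have := cnorm_star u; rewrite uu => u2.
have := @projection_cnorm_le1 1 (conj star1 (mulr1 1)).
by rewrite u2 expr_le1 ?cnorm_ge0.
Qed.

(** An automorphism of a C*-algebra is always isometric, by spectral theory;
    for an approximately inner one it is enough that it is a pointwise limit
    of conjugations by unitaries, which are contractive. *)
Lemma approximately_inner_contractive (alpha : starAut A) :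
  approximately_inner alpha -> forall x, cnorm (alpha x) <= cnorm x.
Proof.
move=> inner x; apply/ler_addgt0Pr => eps eps0.
have [u uu /(_ x (mem_head _ _)) /ltW uxu] := inner [:: x] eps eps0.
have ux : cnorm (u * x * star u) <= cnorm x.
  apply: le_trans (cnormM _ _) _; rewrite cnorm_star_id.
  apply: le_trans (ler_piMr (cnorm_ge0 _) (unitary_cnorm_le1 uu)) _.
  apply: le_trans (cnormM _ _) _.
  exact: ler_piMl (cnorm_ge0 _) (unitary_cnorm_le1 uu).
rewrite -[alpha x](subKr (u * x * star u)).
exact: le_trans (cnormB _ _) (lerD ux uxu).
Qed.

(** * Unitaries near almost unitary elements *)

(** The division by 2 that Newton's iteration for an inverse square root needs has
    to go through the complex scalars. *)
Definition half x : A := cscale (2^-1 : R[i]) x.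

Lemma halfDhalf x : half x + half x = x.
Proof.
rewrite /half -cscaleDl -[RHS](@cscale1 R); congr cscale.
by rewrite -[LHS]mulr2n -[LHS]mulr_natr mulVf // pnatr_eq0.
Qed.

Lemma halfM x y : half x * half y = half (half (x * y)).
Proof. by rewrite /half -cscaleAl -cscaleAr. Qed.

Lemma cnorm_half x : cnorm (half x) = cnorm x / 2.
Proof.
rewrite /half cnormZ Normc.normcV mulrC; congr (_ / _).
have -> : (2 : R[i]) = (2 : R)%:C by rewrite rmorph_nat.
by rewrite /Normc.normc /= expr0n addr0 sqrtr_sqr ger0_norm.
Qed.

Lemma star_half x : star (half x) = half (star x).
Proof.
by rewrite /half starZ fmorphV rmorph_nat.
Qed.

Definition defect x : A := 1 - star x * x.

(** Replacing (x^* x)^(-1/2) = (1 - d)^(-1/2), with d the defect, by its first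
    order expansion 1 + d / 2 in the unitary part x (x^* x)^(-1/2) of x. *)
Definition polar_step x : A := x + half (x * defect x).

Lemma star_defect x : star (defect x) = defect x.
Proof. by rewrite /defect starB star1 starM starK. Qed.

(** Both sides are half of 3 x^* - x^* x x^*.  This symmetry makes every estimate
    on [star x * x] along the iteration also one on [x * star x]. *)
Lemma star_polar_step x : star (polar_step x) = polar_step (star x).
Proof.
rewrite /polar_step starD star_half starM star_defect /defect starK.
by rewrite mulrBl mulrBr mulr1 mul1r mulrA.
Qed.

Lemma defect_polar_step x :
  defect (polar_step x) =
  defect x * defect x
  - half (half (defect x * (1 - defect x) * defect x)).
Proof.
have sxx : star x * x = 1 - defect x by rewrite /defect subKr.
set d := defect x in sxx *.
have e1 : star x * half (x * d) = half (d - d * d).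
  by rewrite /half -cscaleAr mulrA sxx mulrBl mul1r.
have e2 : half (d * star x) * x = half (d - d * d).
  by rewrite /half -cscaleAl -mulrA sxx mulrBr mulr1.
have e3 : half (d * star x) * half (x * d) = half (half (d * (1 - d) * d)).
  by rewrite halfM -sxx !mulrA.
have stepE : polar_step x = x + half (x * d) by [].
have sstepE : star (polar_step x) = star x + half (d * star x).
  by rewrite stepE starD star_half starM star_defect.
rewrite {1}/defect sstepE stepE; clearbody d.
rewrite [X in 1 - X]mulrDl [X in 1 - (X + _)]mulrDr [X in 1 - (_ + X)]mulrDr.
rewrite e1 e2 e3 sxx addrA -[_ + _ + half (d - d * d)]addrA.
rewrite halfDhalf addrA subrK !opprD opprK !addrA.
by rewrite subrr add0r.
Qed.

Lemma cnorm_defect_polar_step x :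
  cnorm (defect x) <= 4^-1 ->
  cnorm (defect (polar_step x)) <= cnorm (defect x) / 2.
Proof.
rewrite defect_polar_step; move: (defect x) => d d_le.
have d0 := cnorm_ge0 d.
have dd : cnorm (d * d) <= cnorm d / 4.
  exact: le_trans (cnormM _ _) (ler_wpM2l d0 d_le).
have ddd : cnorm (d * (1 - d) * d) <= cnorm d / 4 + cnorm d / 16.
  rewrite mulrBr mulr1 mulrBl; apply: le_trans (cnormB _ _) (lerD dd _).
  apply: le_trans (cnormM _ _) _.
  apply: le_trans (ler_pM (cnorm_ge0 _) d0 dd d_le) _.
  by set a := cnorm d; rewrite le_eqVlt; apply/orP; left; apply/eqP; field.
apply: le_trans (cnormB _ _) _; rewrite !cnorm_half.
by move: d0 dd ddd; set a := cnorm d; set b := cnorm _; set c := cnorm _; lra.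
Qed.

Lemma cnorm_le_of_defect x : cnorm (defect x) <= 4^-1 -> cnorm x <= 2.
Proof.
move=> d_le; have: cnorm x ^+ 2 <= 2 ^+ 2.
  rewrite -cnorm_star -[star x * x](subKr 1) -/(defect x).
  apply: le_trans (cnormB _ _) _.
  have := @projection_cnorm_le1 1 (conj star1 (mulr1 1)).
  by move: d_le; set a := cnorm _; set b := cnorm _; lra.
by rewrite ler_pXn2r ?nnegrE ?cnorm_ge0.
Qed.

Lemma cnorm_polar_step x :
  cnorm (defect x) <= 4^-1 -> cnorm (polar_step x - x) <= cnorm (defect x).
Proof.
move=> d_le; rewrite /polar_step addrC addKr cnorm_half ler_pdivrMr //.
rewrite [leRHS]mulrC; apply: le_trans (cnormM _ _) _.
by apply: ler_wpM2r; rewrite ?cnorm_ge0 ?cnorm_le_of_defect.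
Qed.

Definition polar_seq x m : A := iter m polar_step x.

Lemma star_polar_seq x m : star (polar_seq x m) = polar_seq (star x) m.
Proof. by elim: m => //= m <-; rewrite star_polar_step. Qed.

Lemma cnorm_defect_polar_seq x m :
  cnorm (defect x) <= 4^-1 ->
  cnorm (defect (polar_seq x m)) <= cnorm (defect x) / 2 ^+ m /\
  cnorm (defect (polar_seq x m)) <= 4^-1.
Proof.
move=> d_le; elim: m => [|m [IHm d_m]] /=; first by rewrite expr0 divr1.
have d_step := cnorm_defect_polar_step d_m.
split; last by apply: le_trans d_step _; move: d_m; lra.
by apply: le_trans d_step _; rewrite exprSr invfM mulrA ler_pM2r ?invr_gt0.
Qed.

(** The bound is in telescoping form, which is what the induction on [k] needs. *)
Lemma cnorm_polar_seq_shift x m k :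
  cnorm (defect x) <= 4^-1 ->
  cnorm (polar_seq x (m + k) - polar_seq x m) <=
    2 * cnorm (defect x) * ((2 ^+ m)^-1 - (2 ^+ (m + k))^-1).
Proof.
move=> d_le; elim: k => [|k IHk]; first by rewrite addn0 !subrr cnorm0 mulr0.
rewrite addnS /=; set y := polar_seq x (m + k) in IHk *.
have [y_le y_le4] := cnorm_defect_polar_seq (m + k) d_le.
rewrite -/y in y_le y_le4.
rewrite -[X in cnorm X](subrKA y).
apply: le_trans (cnormD _ _) _.
apply: le_trans (lerD (le_trans (cnorm_polar_step y_le4) y_le) IHk) _.
by rewrite [2 ^+ (m + k).+1]exprSr invfM; lra.
Qed.

Lemma half_pow_small (c eps : R) :
  0 <= c -> 0 < eps -> exists N, forall m, (N <= m)%N -> c / 2 ^+ m < eps.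
Proof.
move=> c0 e0; exists (Num.bound (c / eps)) => m Nm.
rewrite ltr_pdivrMr ?exprn_gt0 // mulrC -ltr_pdivrMr //.
apply: lt_le_trans (archi_boundP (divr_ge0 c0 (ltW e0))) _.
by rewrite -natrX ler_nat (leq_trans Nm) // ltnW // ltn_expl.
Qed.

Lemma cnorm_defect_le x y :
  cnorm (x - y) <= 1 -> cnorm x <= 2 ->
  cnorm (defect y) <= cnorm (defect x) + 5 * cnorm (x - y).
Proof.
move=> xy x2.
have -> : defect y = defect x + (star (x - y) * x + star y * (x - y)).
  rewrite starB [X in _ + (X + _)]mulrBl [X in _ + (_ + X)]mulrBr subrKA.
  by rewrite /defect subrKA.
have y3 : cnorm y <= 3.
  by have := cnormB x (x - y); rewrite subKr; lra.
apply: le_trans (cnormD _ _) _; rewrite lerD2l.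
apply: le_trans (cnormD _ _) _.
have sxy := cnormM (star (x - y)) x; have syx := cnormM (star y) (x - y).
apply: le_trans (lerD sxy syx) _; rewrite !cnorm_star_id.
have := ler_wpM2l (cnorm_ge0 (x - y)) x2.
have := ler_wpM2r (cnorm_ge0 (x - y)) y3.
by set a := cnorm (x - y); lra.
Qed.

Lemma defect_polar_lim x l :
    cnorm (defect x) <= 4^-1 ->
    (forall eps : R, 0 < eps -> exists N, forall m, (N <= m)%N ->
       cnorm (polar_seq x m - l) < eps) ->
  star l * l = 1.
Proof.
move=> d4 cvg_l; apply/eqP; rewrite eq_sym -subr_eq0; apply/eqP.
apply: (@cnorm0_eq0 R); apply/le_anti; rewrite cnorm_ge0 andbT.
apply/ler_addgt0Pr => eps e0; rewrite add0r.
have e10 : 0 < Num.min 1 (eps / 10) by rewrite lt_min ltr01 /= divr_gt0.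
have e2 : 0 < eps / 2 by rewrite divr_gt0.
have [N1 N1P] := cvg_l _ e10.
have [N2 N2P] := half_pow_small (cnorm_ge0 (defect x)) e2.
set m := maxn N1 N2; set y := polar_seq x m.
have := N1P m (leq_maxl _ _); rewrite -/y lt_min => /andP[/ltW y1 y2].
have [dy y4] := cnorm_defect_polar_seq m d4.
have dy' := le_lt_trans dy (N2P m (leq_maxr _ _)).
apply: le_trans (cnorm_defect_le y1 (cnorm_le_of_defect y4)) _.
rewrite -/y in dy'; move: y2 dy'.
by set a := cnorm _; set b := cnorm _; lra.
Qed.

(** Newton's iteration for the unitary part of the polar decomposition: it
    squares the defect up to a constant, on both sides at once because it
    commutes with the involution, so it converges to a unitary. *)
Lemma unitary_near_almost_unitary x delta :
    delta <= 4^-1 -> cnorm (defect x) <= delta ->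
    cnorm (defect (star x)) <= delta ->
  exists2 u, unitary u & cnorm (u - x) <= 2 * delta.
Proof.
move=> d4 dx dsx; have dx4 := le_trans dx d4; have dsx4 := le_trans dsx d4.
have c0 : 0 <= 2 * cnorm (defect x) by rewrite mulr_ge0 ?cnorm_ge0.
have shift m k : cnorm (polar_seq x (m + k) - polar_seq x m)
    <= 2 * cnorm (defect x) / 2 ^+ m.
  apply: le_trans (cnorm_polar_seq_shift _ _ dx4) _.
  by rewrite ler_wpM2l // gerBl invr_ge0 exprn_ge0.
have [|l cvg_l] := @cnorm_complete R A (polar_seq x).
  move=> eps e0; have e2 : 0 < eps / 2 by rewrite divr_gt0.
  have [N NP] := half_pow_small c0 e2.
  exists N => m k Nm Nk; rewrite -(subrKA (polar_seq x N)).
  apply: le_lt_trans (cnormD _ _) _; rewrite [X in _ + X]cnorm_sym.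
  have := le_lt_trans (shift N (m - N)%N) (NP N (leqnn _)).
  have := le_lt_trans (shift N (k - N)%N) (NP N (leqnn _)).
  by rewrite !subnKC //; set a := cnorm _; set b := cnorm _; lra.
exists l.
  split; first exact: defect_polar_lim dx4 cvg_l.
  rewrite -{1}[l]starK; apply: (@defect_polar_lim (star x)) => // eps e0.
  have [N NP] := cvg_l eps e0; exists N => m Nm.
  by rewrite -star_polar_seq -starB cnorm_star_id NP.
apply/ler_addgt0Pr => eps e0; have [N /(_ N (leqnn _)) NP] := cvg_l eps e0.
rewrite -(subrKA (polar_seq x N)); apply: le_trans (cnormD _ _) _.
rewrite [X in X + _]cnorm_sym addrC lerD ?(ltW NP) //.
by apply: le_trans (shift 0 N) _; rewrite expr0 divr1 ler_wpM2l.
Qed.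

End CStarNorm.

(** * The sequence algebra *)

Section BoundedSequences.
Variables (R : realType) (A : unitalCStarAlgType R).

Definition bounded_seq : {pred nat -> A} :=
  fun x => `[< exists M : R, forall m, cnorm (x m) <= M >].

Lemma bounded_seqP (x : nat -> A) :
  reflect (exists M : R, forall m, cnorm (x m) <= M) (x \in bounded_seq).
Proof. exact: asboolP. Qed.

Lemma bounded_seq_subring : subring_closed bounded_seq.
Proof.
split; first by apply/bounded_seqP; exists (cnorm (1 : A)).
- move=> x y /bounded_seqP[M xM] /bounded_seqP[N yN].
  apply/bounded_seqP; exists (M + N) => m.
  exact: le_trans (cnormB _ _) (lerD (xM m) (yN m)).
- move=> x y /bounded_seqP[M xM] /bounded_seqP[N yN].
  apply/bounded_seqP; exists (M * N) => m; apply: le_trans (cnormM _ _) _.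
  by apply: ler_pM (cnorm_ge0 _) (cnorm_ge0 _) (xM m) (yN m).
Qed.

HB.instance Definition _ :=
  GRing.isSubringClosed.Build (nat -> A) bounded_seq bounded_seq_subring.

Record bseq := BSeq {
  bseq_fun :> nat -> A;
  bseq_bounded : bseq_fun \in bounded_seq }.

HB.instance Definition _ := [isSub for bseq_fun].
HB.instance Definition _ := [Choice of bseq by <:].
HB.instance Definition _ :=
  GRing.SubChoice_isSubPzRing.Build _ _ bseq (subringClosedP _).

Implicit Types x y : bseq.

Lemma bseqD x y m : (x + y) m = x m + y m. Proof. by []. Qed.
Lemma bseqN x m : (- x) m = - x m. Proof. by []. Qed.
Lemma bseqM x y m : (x * y) m = x m * y m. Proof. by []. Qed.
Lemma bseq0 m : (0 : bseq) m = 0. Proof. by []. Qed.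

Lemma cst_bounded (a : A) : (fun=> a) \in bounded_seq.
Proof. by apply/bounded_seqP; exists (cnorm a). Qed.

Definition bseq_cst (a : A) : bseq := BSeq (cst_bounded a).

Lemma bseqX x k m : (x ^+ k) m = x m ^+ k.
Proof. by elim: k => // k IHk; rewrite !exprS bseqM IHk. Qed.

Lemma bseq_sum (I : finType) (x : I -> bseq) m :
  (\sum_i x i) m = \sum_i x i m.
Proof. exact: (big_morph (fun y : bseq => y m)). Qed.

Definition null_seq : {pred bseq} :=
  fun x => `[< forall eps : R, 0 < eps ->
                 (\forall m \near \oo, cnorm (x m) < eps) >].

Lemma null_seqP x : reflect (forall eps : R, 0 < eps ->
  (\forall m \near \oo, cnorm (x m) < eps)) (x \in null_seq).
Proof. exact: asboolP. Qed.

Lemma bseq_pos_bound x : exists2 M : R, 0 < M & forall m, cnorm (x m) <= M.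
Proof.
have /bounded_seqP[M xM] := bseq_bounded x; exists (`|M| + 1).
  by rewrite ltr_wpDl.
move=> m; apply: le_trans (xM m) (le_trans (ler_norm M) _).
by rewrite lerDl.
Qed.

Lemma null_seq_zmod : zmod_closed null_seq.
Proof.
split=> [|x y /null_seqP x0 /null_seqP y0]; apply/null_seqP => eps e0.
  by apply: nearW => m; rewrite bseq0 cnorm0.
have e2 : 0 < eps / 2 by rewrite divr_gt0.
apply: filterS2 (x0 _ e2) (y0 _ e2) => m xm ym.
rewrite bseqD bseqN; apply: le_lt_trans (cnormB _ _) _.
by rewrite [eps]splitr ltrD.
Qed.

HB.instance Definition _ :=
  GRing.isZmodClosed.Build bseq null_seq null_seq_zmod.

(** The two absorption properties need a bound on the other factor; this is why
    the sequences are bounded. *)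
Lemma null_seqMl x y : y \in null_seq -> x * y \in null_seq.
Proof.
have [M M0 xM] := bseq_pos_bound x.
move=> /null_seqP y0; apply/null_seqP => eps e0.
apply: filterS (y0 _ (divr_gt0 e0 M0)) => m.
rewrite ltr_pdivlMr // mulrC bseqM; apply: le_lt_trans.
apply: le_trans (cnormM _ _) _.
by rewrite ler_wpM2r ?cnorm_ge0.
Qed.

Lemma null_seqMr x y : x \in null_seq -> x * y \in null_seq.
Proof.
have [M M0 yM] := bseq_pos_bound y.
move=> /null_seqP x0; apply/null_seqP => eps e0.
apply: filterS (x0 _ (divr_gt0 e0 M0)) => m.
rewrite ltr_pdivlMr // bseqM; apply: le_lt_trans.
apply: le_trans (cnormM _ _) _.
by rewrite ler_wpM2l ?cnorm_ge0.
Qed.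

(** The quotient of the bounded sequences by the null sequences, usually written
    as l^oo(A) / c_0(A). *)
Definition seqalg : Type := Quotient.quot null_seq.
HB.instance Definition _ := GRing.Zmodule.on seqalg.

Definition seq_class : bseq -> seqalg := \pi_(Quotient.quot null_seq)%qT.
Definition seq_repr : seqalg -> bseq := generic_quotient.repr.

Lemma seq_reprK : cancel seq_repr seq_class.
Proof. exact: reprK. Qed.

Lemma seq_classP x y : seq_class x = seq_class y <-> x - y \in null_seq.
Proof.
rewrite Quotient.idealrBE; split; first by move/eqP.
by move/eqP.
Qed.

Lemma seq_class_zmod_morphism : zmod_morphism seq_class.
Proof. by move=> x y; exact: raddfB. Qed.
HB.instance Definition _ :=
  Algebra.isZmodMorphism.Build bseq seqalg seq_class seq_class_zmod_morphism.


Lemma seq_class_reprM x y :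
  seq_class (seq_repr (seq_class x) * seq_repr (seq_class y)) =
  seq_class (x * y).
Proof.
apply/seq_classP; set x' := seq_repr _; set y' := seq_repr (seq_class y).
have -> : x' * y' - x * y = (x' - x) * y' + x * (y' - y).
  by rewrite mulrBl mulrBr subrKA.
apply: rpredD; first by apply/null_seqMr/seq_classP/seq_reprK.
exact/null_seqMl/seq_classP/seq_reprK.
Qed.

Definition seqalg_one : seqalg := seq_class 1.
Definition seqalg_mul (a b : seqalg) : seqalg :=
  seq_class (seq_repr a * seq_repr b).

Lemma seqalg_mulE x y :
  seqalg_mul (seq_class x) (seq_class y) = seq_class (x * y).
Proof. exact: seq_class_reprM. Qed.

Lemma seq_classD x y : seq_class (x + y) = seq_class x + seq_class y.
Proof. exact: raddfD. Qed.

Lemma seqalg_ind (P : seqalg -> Prop) :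
  (forall x, P (seq_class x)) -> forall a, P a.
Proof. by move=> Px a; rewrite -(seq_reprK a). Qed.

Lemma seqalg_mulA : associative seqalg_mul.
Proof.
do 3![elim/seqalg_ind=> ?].
by rewrite !seqalg_mulE mulrA.
Qed.

Lemma seqalg_mul1s : left_id seqalg_one seqalg_mul.
Proof. by elim/seqalg_ind=> x; rewrite seqalg_mulE mul1r. Qed.

Lemma seqalg_muls1 : right_id seqalg_one seqalg_mul.
Proof. by elim/seqalg_ind=> x; rewrite seqalg_mulE mulr1. Qed.

Lemma seqalg_mulDl : left_distributive seqalg_mul +%R.
Proof.
do 3![elim/seqalg_ind=> ?].
by rewrite -seq_classD !seqalg_mulE mulrDl seq_classD.
Qed.

Lemma seqalg_mulDr : right_distributive seqalg_mul +%R.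
Proof.
do 3![elim/seqalg_ind=> ?].
by rewrite -seq_classD !seqalg_mulE mulrDr seq_classD.
Qed.

HB.instance Definition _ := GRing.Zmodule_isPzRing.Build seqalg
  seqalg_mulA seqalg_mul1s seqalg_muls1 seqalg_mulDl seqalg_mulDr.

Lemma seq_class_monoid_morphism : monoid_morphism seq_class.
Proof. by split=> // x y; rewrite -seqalg_mulE. Qed.

HB.instance Definition _ :=
  GRing.isMonoidMorphism.Build bseq seqalg seq_class seq_class_monoid_morphism.

Lemma star_bounded x : (fun m => star (x m)) \in bounded_seq.
Proof.
have /bounded_seqP[M xM] := bseq_bounded x; apply/bounded_seqP; exists M => m.
by rewrite cnorm_star_id.
Qed.

Definition bseq_star x : bseq := BSeq (star_bounded x).

Definition seqalg_star (a : seqalg) : seqalg :=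
  seq_class (bseq_star (seq_repr a)).

Lemma bseqP x y : (forall m, x m = y m) -> x = y.
Proof. by move=> xy; apply/val_inj/funext. Qed.

Lemma seq_class_eqP x y : seq_class x = seq_class y <->
  forall eps : R, 0 < eps -> (\forall m \near \oo, cnorm (x m - y m) < eps).
Proof.
rewrite seq_classP; split=> [xy|xy]; last by apply/null_seqP; exact: xy.
by move/null_seqP: xy => xy; exact: xy.
Qed.

Lemma invS_small (eps : R) : 0 < eps -> (\forall m \near \oo, m.+1%:R^-1 < eps).
Proof.
move=> e0; exists (Num.bound eps^-1) => [|m /= Nm]; first by [].
have einv : 0 <= eps^-1 by apply: ltW; rewrite invr_gt0.
rewrite invf_plt ?posrE //; apply: lt_le_trans (archi_boundP einv) _.
by rewrite ler_nat leqW.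
Qed.

Lemma seq_class_eq_invS x y :
  (forall m, cnorm (x m - y m) < m.+1%:R^-1) -> seq_class x = seq_class y.
Proof.
move=> xy; apply/seq_class_eqP => eps e0; apply: filterS (invS_small e0) => m.
exact: lt_trans.
Qed.

Lemma seqalg_starE x : seqalg_star (seq_class x) = seq_class (bseq_star x).
Proof.
apply/seq_class_eqP => eps e0.
have /seq_class_eqP/(_ _ e0) := seq_reprK (seq_class x); apply: filterS => m.
by rewrite /= -starB cnorm_star_id.
Qed.

Lemma seqalg_starK : involutive seqalg_star.
Proof.
elim/seqalg_ind=> x; rewrite !seqalg_starE; congr seq_class; apply: bseqP => m.
exact: starK.
Qed.

Lemma seqalg_starD : {morph seqalg_star : a b / a + b}.
Proof.
do 2![elim/seqalg_ind=> ?]; rewrite -seq_classD !seqalg_starE -seq_classD.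
by congr seq_class; apply: bseqP => m /=; rewrite starD.
Qed.

Lemma seqalg_starM a b : seqalg_star (a * b) = seqalg_star b * seqalg_star a.
Proof.
elim/seqalg_ind: a => x; elim/seqalg_ind: b => y.
rewrite -rmorphM !seqalg_starE -rmorphM.
by congr seq_class; apply: bseqP => m /=; rewrite starM.
Qed.

(** A contractive automorphism preserves boundedness and convergence to 0, hence
    acts on the sequence algebra. *)
Section SeqAut.
Variable alpha : starAut A.
Hypothesis alpha_le : forall a : A, cnorm (alpha a) <= cnorm a.

Lemma aut_bounded x : (fun m => alpha (x m)) \in bounded_seq.
Proof.
have /bounded_seqP[M xM] := bseq_bounded x; apply/bounded_seqP; exists M => m.
exact: le_trans (alpha_le _) (xM m).
Qed.

Definition bseq_aut x : bseq := BSeq (aut_bounded x).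

Definition seqalg_aut (a : seqalg) : seqalg :=
  seq_class (bseq_aut (seq_repr a)).

Lemma seqalg_autE x : seqalg_aut (seq_class x) = seq_class (bseq_aut x).
Proof.
apply/seq_class_eqP => eps e0.
have /seq_class_eqP/(_ _ e0) := seq_reprK (seq_class x); apply: filterS => m.
by rewrite /= -rmorphB; apply: le_lt_trans.
Qed.

Lemma seqalg_autB : zmod_morphism seqalg_aut.
Proof.
do 2![elim/seqalg_ind=> ?]; rewrite -raddfB !seqalg_autE -raddfB.
by congr seq_class; apply: bseqP => m /=; rewrite rmorphB.
Qed.

Lemma seqalg_aut_monoid : monoid_morphism seqalg_aut.
Proof.
split; first by rewrite -(rmorph1 seq_class) seqalg_autE;
  congr seq_class; apply: bseqP => m /=; rewrite rmorph1.
do 2![elim/seqalg_ind=> ?]; rewrite -rmorphM !seqalg_autE -rmorphM.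
by congr seq_class; apply: bseqP => m /=; rewrite rmorphM.
Qed.

HB.instance Definition _ :=
  Algebra.isZmodMorphism.Build seqalg seqalg seqalg_aut seqalg_autB.
HB.instance Definition _ :=
  GRing.isMonoidMorphism.Build seqalg seqalg seqalg_aut seqalg_aut_monoid.

Lemma seqalg_aut_star : {morph seqalg_aut : a / seqalg_star a}.
Proof.
elim/seqalg_ind=> x; rewrite seqalg_starE !seqalg_autE seqalg_starE.
by congr seq_class; apply: bseqP => m /=; rewrite aut_star.
Qed.

Lemma iter_bseq_aut k x m : iter k bseq_aut x m = iter k alpha (x m).
Proof. by elim: k => //= k ->. Qed.

Lemma iter_seqalg_aut k x :
  iter k seqalg_aut (seq_class x) = seq_class (iter k bseq_aut x).
Proof. by elim: k => //= k ->; rewrite seqalg_autE. Qed.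

Lemma seqalg_aut_n n : iter n alpha =1 id -> iter n seqalg_aut =1 id.
Proof.
move=> alpha_n; elim/seqalg_ind=> x; rewrite iter_seqalg_aut; congr seq_class.
by apply: bseqP => m; rewrite iter_bseq_aut alpha_n.
Qed.

End SeqAut.

Lemma unitary_bounded (u : nat -> A) :
  (forall m, unitary (u m)) -> u \in bounded_seq.
Proof.
move=> uU; apply/bounded_seqP; exists 1 => m; exact: unitary_cnorm_le1 (uU m).
Qed.

Lemma projection_bounded (p : nat -> A) :
  (forall m, projection (p m)) -> p \in bounded_seq.
Proof.
move=> pP; apply/bounded_seqP; exists 1 => m.
exact: projection_cnorm_le1 (pP m).
Qed.

(** A representative of [w] is almost unitary at all large indices, where it can be
    corrected to a nearby unitary; at the other indices any unitary will do. *)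
Lemma unitary_lift (w : seqalg) : unitary_for seqalg_star w ->
  exists2 v : bseq, (forall m, unitary (v m)) & seq_class v = w.
Proof.
case=> ww1 ww2; pose x := seq_repr w.
have dx1 eps : 0 < eps -> (\forall m \near \oo, cnorm (defect (x m)) < eps).
  move: eps; have /seq_class_eqP : seq_class 1 = seq_class (bseq_star x * x).
    by rewrite rmorph1 rmorphM /= -seqalg_starE seq_reprK.
  by [].
have dx2 eps : 0 < eps ->
    \forall m \near \oo, cnorm (defect (star (x m))) < eps.
  move: eps; have /seq_class_eqP : seq_class 1 = seq_class (x * bseq_star x).
    by rewrite rmorph1 rmorphM /= -seqalg_starE seq_reprK.
  move=> small eps e0; apply: filterS (small eps e0) => m.
  by rewrite /defect starK.
pose delta m := cnorm (defect (x m)) + cnorm (defect (star (x m))).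
have near m : exists u, unitary u /\
    (delta m <= 4^-1 -> cnorm (u - x m) <= 2 * delta m).
  have [d4|d4] := leP (delta m) 4^-1; last first.
    by exists 1; split=> //; rewrite /unitary star1 mul1r.
  have [||u uU ux] := @unitary_near_almost_unitary _ _ (x m) _ d4;
    last by exists u.
    by rewrite lerDl cnorm_ge0.
  by rewrite lerDr cnorm_ge0.
have [v vP] := choice near.
have vU m : unitary (v m) by case: (vP m).
exists (BSeq (unitary_bounded vU)) => //; rewrite -(seq_reprK w) -/x.
apply/seq_class_eqP => eps e0.
have d0 : 0 < Num.min 8^-1 (eps / 5) by rewrite lt_min invr_gt0 divr_gt0 ?ltr0n.
apply: filterS2 (dx1 _ d0) (dx2 _ d0) => m.
rewrite !lt_min => /andP[a1 a2] /andP[b1 b2] /=.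
have /(vP m).2 : delta m <= 4^-1 by rewrite /delta; move: a1 b1; lra.
by move/le_lt_trans; apply; rewrite /delta; move: a2 b2; lra.
Qed.

End BoundedSequences.

(** * Saturation *)

Section Saturation.
Variables (R : realType) (A : unitalCStarAlgType R) (alpha : starAut A).
Hypothesis alpha_le : forall a : A, cnorm (alpha a) <= cnorm a.

(** The [m]-th term of [u] is a unitary that works up to 1/(m+1) for the [m]-th
    terms of representatives of the elements of [F]. *)
Lemma seqalg_inner : approximately_inner alpha ->
  forall F : seq (seqalg A), exists2 u, unitary_for (@seqalg_star R A) u &
    intertwines (seqalg_aut alpha_le) F u.
Proof.
move=> inner F.
have near m : exists u, unitary u /\ forall a, a \in F ->
    cnorm (u * seq_repr a m * star u - alpha (seq_repr a m)) < m.+1%:R^-1.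
  have m0 : 0 < m.+1%:R^-1 :> R by rewrite invr_gt0.
  have [u uU uF] := inner [seq seq_repr a m | a <- F] _ m0.
  by exists u; split=> // a aF; apply: uF; apply: map_f.
have [u /all_and2[uU uF]] := choice near.
exists (seq_class (BSeq (unitary_bounded uU))).
  rewrite /unitary_for seqalg_starE -!rmorphM -(rmorph1 (@seq_class R A)).
  by split; congr seq_class; apply: bseqP => m; case: (uU m).
move=> a aF; rewrite -[a]seq_reprK /= seqalg_autE -!rmorphM.
apply: seq_class_eq_invS => m; apply: le_lt_trans (uF m a aF).
rewrite !bseqM /=.
have -> : u m * seq_repr a m - alpha (seq_repr a m) * u m =
    (u m * seq_repr a m * star (u m) - alpha (seq_repr a m)) * u m.
  by rewrite mulrBl -(mulrA _ _ (u m)) (uU m).1 mulr1.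
apply: le_trans (cnormM _ _) _.
exact: ler_piMr (cnorm_ge0 _) (unitary_cnorm_le1 (uU m)).
Qed.

Variables (n : nat) (alpha_n : iter n.+1 alpha =1 id).

(** The same diagonal choice, applied to the projections. *)
Lemma seqalg_rokhlin : strict_Rokhlin (cyclic_action alpha_n) ->
  forall F : seq (seqalg A),
  exists2 e : 'I_n.+1 -> seqalg A,
    rokhlin_tower (@seqalg_star R A) (seqalg_aut alpha_le) e &
    forall i a, a \in F -> e i * a = a * e i.
Proof.
move=> rokhlin F.
have near m : exists e : 'I_n.+1 -> A,
    [/\ (forall i, projection (e i)) /\ (forall i j, i != j -> e i * e j = 0),
        (forall i, cnorm (alpha (e i) - e (ordS i)) < m.+1%:R^-1),
        (forall i a, a \in F ->
           cnorm (e i * seq_repr a m - seq_repr a m * e i) < m.+1%:R^-1) &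
        \sum_i e i = 1].
  have m0 : 0 < m.+1%:R^-1 :> R by rewrite invr_gt0.
  have [e [eP eal eF e1]] := rokhlin [seq seq_repr a m | a <- F] _ m0.
  exists e; split=> // [i|i a aF]; last by apply: eF; apply: map_f.
  (* [ordS ord0] is the class of 1, which is 0 when [n = 0]; then [alpha] is the
     identity, and the reduction of exponents modulo [n.+1] covers both cases. *)
  have := eal (ordS ord0) i; rewrite /= /iter_aut (iter_mod_period alpha_n) //=.
  suff -> : (ordS ord0 * i)%g = ordS i by [].
  by apply: val_inj; rewrite /= modnDml.
have [e eP] := choice near.
have pe i m : projection (e m i) by case: (eP m) => -[].
exists (fun i => seq_class (BSeq (projection_bounded (pe i)))).
  split=> [i|i j|i|].
  - by rewrite seqalg_starE; congr seq_class; apply: bseqP => m; case: (pe i m).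
  - have [<-|ij] := eqVneq i j; rewrite -?(raddf0 (@seq_class R A)) -rmorphM.
      by congr seq_class; apply: bseqP => m; case: (pe i m).
    by congr seq_class; apply: bseqP => m; case: (eP m) => -[_ /(_ _ _ ij)].
  - by rewrite /= seqalg_autE; apply: seq_class_eq_invS => m /=; case: (eP m).
  - rewrite -raddf_sum -(rmorph1 (@seq_class R A)); congr seq_class.
    by apply: bseqP => m; rewrite bseq_sum; case: (eP m).
move=> i a aF; rewrite -[a]seq_reprK -!rmorphM; apply: seq_class_eq_invS => m.
by case: (eP m) => _ _ /(_ i a aF).
Qed.

End Saturation.

(** * Approximate representability *)

Theorem proposition4p1 (R : realType) (A : unitalCStarAlgType R)
    (sepA : separable A) (n : nat) (alpha : starAut A)
    (alpha_inner : approximately_inner alpha)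
    (alpha_n : iter n.+1 alpha =1 id)
    (alpha_Rokhlin : strict_Rokhlin (cyclic_action alpha_n)) :
  approximately_representable (cyclic_action alpha_n).
Proof.
split.
  by apply/centsP => i _ j _; apply: val_inj; rewrite /= addnC.
move=> F eps e0.
have alpha_le := approximately_inner_contractive alpha_inner.
pose al := seqalg_aut alpha_le.
(* The algebraic argument needs a finite set that is stable under [al]. *)
pose orbits :=
  [seq seq_class (bseq_cst (iter k alpha a)) | a <- F, k <- iota 0 n.+1].
have orbitsP k a : a \in F -> seq_class (bseq_cst (iter k alpha a)) \in orbits.
  move=> aF; apply/allpairsP; exists (a, (k %% n.+1)%N).
  by rewrite [_.2 \in _]mem_iota add0n ltn_pmod /= ?(iter_mod_period alpha_n).
have orbits_al a : a \in orbits -> al a \in orbits.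
  case/allpairsP => -[b k] /= [bF _ ->].
  by rewrite /al seqalg_autE (_ : bseq_aut _ _ = bseq_cst (iter k.+1 alpha b))
    ?orbitsP //; apply: bseqP.
have [w [wU wN alw wF]] := exists_invariant_periodic_intertwiner
  (@seqalg_starK R A) (@seqalg_starD R A) (@seqalg_starM R A)
  (seqalg_aut_star alpha_le) (seqalg_aut_n alpha_le alpha_n) orbits_al
  (seqalg_inner alpha_le alpha_inner) (seqalg_rokhlin alpha_le alpha_Rokhlin).
have [v vU vw] := unitary_lift wU.
have wXU k := unitary_forX (@seqalg_starK R A) (@seqalg_starM R A) k wU.
have covariance (g : 'I_n.+1) a : a \in F -> \forall m \near \oo,
    cnorm (iter g alpha a - v m ^+ g * a * star (v m ^+ g)) < eps.
  move=> aF.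
  have /seq_class_eqP/(_ eps e0) :
      seq_class (iter g (bseq_aut alpha_le) (bseq_cst a)) =
      seq_class (v ^+ g * bseq_cst a * bseq_star (v ^+ g)).
    rewrite -iter_seqalg_aut !rmorphM /= -seqalg_starE rmorphXn /= vw.
    rewrite (iter_intertwines _ orbits_al wF) ?(orbitsP 0) //.
    by rewrite -mulrA; case: (wXU g) => _ ->; rewrite mulr1.
  by apply: filterS => m; rewrite iter_bseq_aut !bseqM /= bseqX.
have multiplicativity (g h : 'I_n.+1) : \forall m \near \oo,
    cnorm (v m ^+ g * v m ^+ h - v m ^+ (g * h)%g) < eps.
  have /seq_class_eqP/(_ eps e0) :
      seq_class (v ^+ g * v ^+ h) = seq_class (v ^+ (g * h)%g).
    by rewrite rmorphM !rmorphXn /= vw -exprD -(expr_mod _ wN).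
  by apply: filterS => m; rewrite bseqM !bseqX.
have invariance (g h : 'I_n.+1) : \forall m \near \oo,
    cnorm (iter g alpha (v m ^+ h) - v m ^+ h) < eps.
  have /seq_class_eqP/(_ eps e0) :
      seq_class (iter g (bseq_aut alpha_le) (v ^+ h)) = seq_class (v ^+ h).
    rewrite -iter_seqalg_aut rmorphXn /= vw.
    by elim: (nat_of_ord g) => //= k ->; rewrite rmorphXn /= alw.
  by apply: filterS => m; rewrite iter_bseq_aut bseqX.
have [m [cov mul inv]] : exists m,
    [/\ forall (g : 'I_n.+1) (a : seq_sub F),
          cnorm (iter g alpha (ssval a)
                 - v m ^+ g * ssval a * star (v m ^+ g)) < eps,
        forall g h : 'I_n.+1,
          cnorm (v m ^+ g * v m ^+ h - v m ^+ (g * h)%g) < eps &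
        forall g h : 'I_n.+1,
          cnorm (iter g alpha (v m ^+ h) - v m ^+ h) < eps].
  apply: (@filter_ex _ \oo); near=> m; split; near: m.
  - by do 2![apply: filter_forall => ?]; apply/covariance/ssvalP.
  - by do 2![apply: filter_forall => ?].
  - by do 2![apply: filter_forall => ?].
exists (fun g : 'I_n.+1 => v m ^+ g); split=> // [g|g a aF].
  exact: (unitary_forX (@starK R A) (@starM R A) _ (vU m)).
exact: cov g (SeqSub aF).
Unshelve. all: by end_near. Qed.
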